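(* Let $X$ be a topological space. (1) $X$ is strategically $\omega$-Menger if and only if it is strategically Menger. (2) $X$ is strategically $\omega$-Rothberger if and only if it is strategically Rothberger.
   Context: No separation axioms are assumed. $\mathcal O_X$ denotes the set of all open covers of $X$, and $\Omega_X$ the set of all $\omega$-covers of $X$, i.e. open covers $\mathscr U$ of $X$ such that every finite subset of $X$ is contained in a member of $\mathscr U$. $[S]^{<\omega}$ is the set of finite subsets of $S$. For $\mathcal A\in\{\mathcal O_X,\Omega_X\}$, the games $\mathsf G_1(\mathcal A,\mathcal A)$ and $\mathsf G_{\mathrm{fin}}(\mathcal A,\mathcal A)$ have length $\omega$. In round $n\in\omega$ of $\mathsf G_1(\mathcal A,\mathcal A)$ (resp. $\mathsf G_{\mathrm{fin}}(\mathcal A,\mathcal A)$), P1 plays $\mathscr U_n\in\mathcal A$ and P2 responds with $U_n\in\mathscr U_n$ (resp. $\mathscr F_n\in[\mathscr U_n]^{<\omega}$). P2 wins if $\{U_n:n\in\omega\}\in\mathcal A$ (resp. $\bigcup\{\mathscr F_n:n\in\omega\}\in\mathcal A$); otherwise P1 wins. A strategy for P2 is a function $\sigma$ assigning to each non-empty finite sequence $\langle\mathscr U_0,\dots,\mathscr U_n\rangle$ in $\mathcal A$ an element of $\mathscr U_n$ (resp. of $[\mathscr U_n]^{<\omega}$); it is winning if P2 wins every run in which P2 responds in each round $n$ with $\sigma(\mathscr U_0,\dots,\mathscr U_n)$. $X$ is strategically Menger, strategically $\omega$-Menger, strategically Rothberger, strategically $\omega$-Rothberger if P2 has a winning strategy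 in $\mathsf G_{\mathrm{fin}}(\mathcal O_X,\mathcal O_X)$, $\mathsf G_{\mathrm{fin}}(\Omega_X,\Omega_X)$, $\mathsf G_1(\mathcal O_X,\mathcal O_X)$, $\mathsf G_1(\Omega_X,\Omega_X)$, respectively.
   Formalization: Part (2) is stated for non-empty X only: for the empty space the empty family is an open cover to which P2 has no reply, so it is not strategically Rothberger, yet its only ω-cover is {∅}, so it is strategically ω-Rothberger. *)

(* Defs.v *)
From HB Require Import structures.
From mathcomp Require Import all_boot.
From mathcomp Require Import all_classical topology.

Set Implicit Arguments.
Unset Strict Implicit.
Unset Printing Implicit Defensive.

Local Open Scope classical_set_scope.

Definition open_cover (X : topologicalType) : set (set (set X)) :=
  [set U | U `<=` open /\ \bigcup_(V in U) V = [set: X]].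

(* The whole space [setT] is allowed as a member of an omega-cover. *)
Definition omega_cover (X : topologicalType) : set (set (set X)) :=
  [set U | open_cover U /\
    forall F : set X, finite_set F -> exists2 V, U V & F `<=` V].

(* A strategy is given by a total function on finite sequences; its values
   outside the non-empty sequences of elements of [A] are irrelevant, since
   legality, runs and winning only refer to the values on such sequences.
   [rcons s U] is the sequence of P1's moves so far, the last one being [U],
   and [mkseq U n.+1] is U_0, ..., U_n. *)

Definition G1_strategy (X : Type) (A : set (set (set X)))
    (sigma : seq (set (set X)) -> set X) : Prop :=
  forall (s : seq (set (set X))) (U : set (set X)),
    {in rcons s U, forall V, A V} -> U (sigma (rcons s U)).

Definition G1_winning (X : Type) (A : set (set (set X)))
    (sigma : seq (set (set X)) -> set X) : Prop :=
  forall U : nat -> set (set X), (forall n, A (U n)) ->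
    A (range (fun n => sigma (mkseq U n.+1))).

Definition P2_wins_G1 (X : Type) (A : set (set (set X))) : Prop :=
  exists2 sigma, G1_strategy A sigma & G1_winning A sigma.

Definition Gfin_strategy (X : Type) (A : set (set (set X)))
    (sigma : seq (set (set X)) -> set (set X)) : Prop :=
  forall (s : seq (set (set X))) (U : set (set X)),
    {in rcons s U, forall V, A V} ->
    finite_set (sigma (rcons s U)) /\ sigma (rcons s U) `<=` U.

Definition Gfin_winning (X : Type) (A : set (set (set X)))
    (sigma : seq (set (set X)) -> set (set X)) : Prop :=
  forall U : nat -> set (set X), (forall n, A (U n)) ->
    A (\bigcup_n sigma (mkseq U n.+1)).

Definition P2_wins_Gfin (X : Type) (A : set (set (set X))) : Prop :=
  exists2 sigma, Gfin_strategy A sigma & Gfin_winning A sigma.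

Definition strategically_Menger (X : topologicalType) : Prop :=
  P2_wins_Gfin (@open_cover X).

Definition strategically_omega_Menger (X : topologicalType) : Prop :=
  P2_wins_Gfin (@omega_cover X).

(* The empty family is an open cover of the empty space, to which P2 has no
   legal answer in G_1: the empty space is not strategically Rothberger. *)
Definition strategically_Rothberger (X : topologicalType) : Prop :=
  P2_wins_G1 (@open_cover X).

Definition strategically_omega_Rothberger (X : topologicalType) : Prop :=
  P2_wins_G1 (@omega_cover X).

(* Main.v *)
(* Rothberger: by Galvin's duality, a winning strategy of P2 is a strategy of P1
   in the game where P1 plays points (finite sets, for omega-covers) and P2 open
   sets containing them. Against points, choosing each open set so that it
   contains the points demanded after every subsequence of the previous choices
   makes every subsequence of choices cover X, so that each point lies in all but
   finitely many choices. Conversely, a finite set can be covered one point at a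
   time.

   Menger: by induction on k, P2 can play against omega-covers so that every set
   of k points is contained in a chosen member; running the strategies for all k
   with staggered starts handles all finite sets. The converse passes to finite
   unions of members of a cover. *)
Require Import Defs.
From mathcomp Require Import all_boot.
From mathcomp Require Import all_classical topology.

Local Open Scope classical_set_scope.

Set Implicit Arguments.
Unset Strict Implicit.
Unset Printing Implicit Defensive.

(** * Strategies with memory and subsequences of runs *)

Definition legal (X : Type) (A : set (set (set X))) (s : seq (set (set X))) :=
  {in s, forall V, A V}.

Lemma legal_rcons (X : Type) (A : set (set (set X))) s U :
  legal A (rcons s U) <-> legal A s /\ A U.
Proof.
split=> [lsU|[ls AU] V].
  by split=> [V Vs|]; apply: lsU; rewrite mem_rcons inE ?Vs ?eqxx ?orbT.
by rewrite mem_rcons inE => /predU1P[->//|/ls].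
Qed.

Lemma legal_mkseq (X : Type) (A : set (set (set X))) (U : nat -> set (set X)) n :
  (forall n, A (U n)) -> legal A (mkseq U n).
Proof. by move=> AU V /mapP[i _ ->]. Qed.

(** A strategy with memory: the earlier moves are folded into a state, and the last move is answered
    from that state. The value on the empty sequence is a dummy. [Y] is the space itself for single
    choices and its powerset for finite selections. *)
Definition machine (S M Y : Type) (step : S -> M -> S) (resp : S -> M -> set Y)
    (s0 : S) (s : seq M) : set Y :=
  if s is u :: t then resp (foldl step s0 (belast u t)) (last u t) else set0.

Lemma machine_rcons (S M Y : Type) (step : S -> M -> S)
    (resp : S -> M -> set Y) s0 s u :
  machine step resp s0 (rcons s u) = resp (foldl step s0 s) u.
Proof. by case: s => [|v t] //=; rewrite belast_rcons last_rcons. Qed.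

Lemma foldl_invariant (X S : Type) (A : set (set (set X))) (I : S -> Prop)
    (step : S -> set (set X) -> S) s0 :
  I s0 -> (forall s U, I s -> A U -> I (step s U)) ->
  forall t, legal A t -> I (foldl step s0 t).
Proof.
move=> I0 IS; elim/last_ind => [|t U IH] // /legal_rcons[lt AU].
by rewrite foldl_rcons; apply: IS => //; exact: IH.
Qed.

Lemma foldl_mkseqS (S M : Type) (step : S -> M -> S) s0 (U : nat -> M) n :
  foldl step s0 (mkseq U n.+1) = step (foldl step s0 (mkseq U n)) (U n).
Proof. by rewrite mkseqS foldl_rcons. Qed.

(** Each next index is sought from the successor of the previous one. The witnesses [y] are selected
    together with the rounds, since later arguments need both. *)
Lemma infinitely_often_subsequence (Y : Type) (P : nat -> Y -> Prop) :
  (forall m, exists n, (m <= n)%N /\ exists y, P n y) ->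
  exists (u : nat -> nat) (y : nat -> Y),
    (forall i, (u i < u i.+1)%N) /\ forall i, P (u i) (y i).
Proof.
move=> Pinf.
have Pex m : exists z : nat * Y, (m <= z.1)%N /\ P z.1 z.2.
  by have [n [mn [y Py]]] := Pinf m; exists (n, y).
have [f fP] := choice Pex.
pose u := fix u i := if i is j.+1 then (f (u j).+1).1 else (f 0).1.
exists u, (fun i => if i is j.+1 then (f (u j).+1).2 else (f 0).2).
by split=> [i|[|i]]; [have [] := fP (u i).+1|have [] := fP 0|
  have [] := fP (u i).+1].
Qed.

(* Keeping every old history when extending histories makes all subsequences
   of a run available as histories. *)
Lemma subsequence_history (M : Type) (H : nat -> set (seq M)) (u : nat -> nat)
    (c : nat -> M) :
  (forall n, H 0 [::] /\ H n `<=` H n.+1) ->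
  (forall i, (u i < u i.+1)%N) ->
  (forall i h, H (u i) h -> H (u i).+1 (rcons h (c i))) ->
  forall j, H (u j) (mkseq c j).
Proof.
move=> Hmon uS HS.
have Hle m n : (m <= n)%N -> H m `<=` H n.
  elim: n => [|n IH]; first by rewrite leqn0 => /eqP->.
  rewrite leq_eqVlt => /predU1P[->//|mn] h /(IH mn); exact: (Hmon n).2.
elim=> [|j IH]; first exact: (Hle 0 _ (leq0n _) _ (Hmon 0).1).
by rewrite mkseqS; apply: (Hle _ _ (uS j)); exact: HS.
Qed.

Lemma open_finite_bigcap (X : topologicalType) (F : set (set X)) :
  finite_set F -> F `<=` open -> open (\bigcap_(W in F) W).
Proof.
move=> /finite_seqP[s ->]; elim: s => [|V s IH] so.
  by rewrite set_nil bigcap_set0; exact: openT.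
have -> : \bigcap_(W in [set` V :: s]) W = V `&` \bigcap_(W in [set` s]) W.
  apply/seteqP; split=> [x xs|x [Vx xs] W].
    split=> [|W Ws]; first by apply: xs; rewrite /= mem_head.
    by apply: xs; rewrite /= inE; apply/orP; right.
  by rewrite /= inE => /predU1P[->|/xs].
apply: openI; first by apply: so; rewrite /= mem_head.
by apply: IH => W Ws; apply: so; rewrite /= inE; apply/orP; right.
Qed.

(** Sets of preimages are chosen instead of preimages, so that no default element of [T] is
    required. *)
Lemma finite_subset_range (T Y : Type) (f : T -> Y) (B : set Y) :
  finite_set B -> B `<=` range f -> exists2 A, finite_set A & B = f @` A.
Proof.
move=> Bf Bf'.
have /choice[g gP] y : exists C, finite_set C /\ (B y -> f @` C = [set y]).
  have [/Bf'[x _ <-]|nB] := pselect (B y).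
    by exists [set x]; rewrite image_set1; split=> //; exact: finite_set1.
  by exists set0; split=> [|/nB//]; exact: finite_set0.
exists (\bigcup_(y in B) g y).
  by apply: bigcup_finite => // y _; have [] := gP y.
rewrite image_bigcup; apply/seteqP; split=> [y By|y [z Bz]].
  by exists y => //; have [_ ->] := gP y.
by have [_ ->//] := gP z => ->.
Qed.

(** * The Rothberger games *)

Section Rothberger.
Variable X : topologicalType.

(* After each legal history some [D i] is such that every open set containing
   it is a possible reply of P2: otherwise, choosing for each [i] an open set
   containing [D i] that is never a reply gives a member of [A] to which P2 has
   no reply. *)
Lemma P1_dual_strategy (A : set (set (set X))) (I : Type) (i0 : I)
    (D : I -> set X) :
  (forall V : I -> set X, (forall i, open (V i) /\ D i `<=` V i) ->
    A (range V)) ->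
  P2_wins_G1 A ->
  exists p : seq (set X) -> I, forall V : nat -> set X,
    (forall n, open (V n) /\ D (p (mkseq V n)) `<=` V n) -> A (range V).
Proof.
move=> AV [sigma sigmaS sigmaW].
have answer t : exists i, legal A t -> forall V, open V -> D i `<=` V ->
    exists U, A U /\ sigma (rcons t U) = V.
  case: (pselect (legal A t)) => [lt|]; last by exists i0.
  apply: contrapT => /forallNP noi.
  have avoid i : exists V, [/\ open V, D i `<=` V &
      forall U, A U -> sigma (rcons t U) <> V].
    apply: contrapT => noV; apply: (noi i) => _ V oV DV.
    apply: contrapT => noU; apply: noV; exists V; split=> // U AU sU.
    by apply: noU; exists U.
  have [V HV] := choice avoid.
  have AR : A (range V) by apply: AV => i; have [] := HV i.
  have [i _ Vi] : range V (sigma (rcons t (range V))).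
    by apply: sigmaS; exact/legal_rcons.
  by have [_ _ /(_ _ AR)] := HV i; rewrite Vi.
have [dp Hdp] := choice answer.
have cover (tV : seq (set (set X)) * set X) : exists U, legal A tV.1 ->
    open tV.2 -> D (dp tV.1) `<=` tV.2 -> A U /\ sigma (rcons tV.1 U) = tV.2.
  case: tV => t V /=.
  case: (pselect (legal A t /\ open V /\ D (dp t) `<=` V)) => [[lt [oV DV]]|].
    by have [U HU] := Hdp t lt V oV DV; exists U.
  by move=> nH; exists set0 => lt oV DV; case: nH.
have [cv Hcv] := choice cover.
(* [h] turns open sets played against [p] into covers to which [sigma] replies with exactly these
   sets; a run against [p] thus becomes a run of [sigma]. *)
pose h := foldl (fun t V => rcons t (cv (t, V))) [::].
exists (dp \o h) => V HV.
pose U n := cv (h (mkseq V n), V n).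
have hE n : h (mkseq V n) = mkseq U n.
  by elim: n => // n IH; rewrite /h foldl_mkseqS -/h mkseqS -IH.
have lU n : legal A (mkseq U n).
  elim: n => // n IH; rewrite mkseqS; apply/legal_rcons; split=> //.
  have [oV DV] := HV n.
  by have [] := Hcv (h (mkseq V n), V n) _ oV DV; rewrite //= hE.
have UP n : A (U n) /\ sigma (mkseq U n.+1) = V n.
  rewrite mkseqS -hE; have [oV DV] := HV n.
  by apply: (Hcv (h (mkseq V n), V n)); rewrite //= hE.
have -> : V = fun n => sigma (mkseq U n.+1) by apply/funext => n; have [] := UP n.
by apply: sigmaW => n; have [] := UP n.
Qed.

Lemma Rothberger_omega : [set: X] !=set0 ->
  strategically_Rothberger X -> strategically_omega_Rothberger X.
Proof.
move=> [x0 _] /(@P1_dual_strategy _ X x0 (@set1 X)) [V oV|p pW].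
  split=> [_ [i _ <-]|]; first by have [] := oV i.
  apply/seteqP; split=> // x _; exists (V x); first by exists x.
  by have [_ ] := oV x; apply.
pose respP (H : set (seq (set X))) (U : set (set X)) W :=
  U W /\ forall h, H h -> W (p h).
have /choice[resp Hresp] (z : set (seq (set X)) * set (set X)) : exists W,
    finite_set z.1 -> omega_cover z.2 -> respP z.1 z.2 W.
  case: z => H U /=.
  have [[Hf oU]|nH] := pselect (finite_set H /\ omega_cover U); last first.
    by exists set0 => Hf oU; case: nH.
  have [_ /(_ _ (finite_image p Hf))[W UW HW]] := oU.
  by exists W => _ _; split=> // h Hh; apply: HW; exists h.
(* The state is the set of all subsequences of the choices so far. It stays finite, so some member
   of an omega-cover contains every point that [p] demands after them. *)
pose step H U := H `|` [set rcons h (resp (H, U)) | h in H].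
pose sigma := machine step (fun H U => resp (H, U)) [set [::]].
have Hfin t : legal (@omega_cover X) t ->
    finite_set (foldl step [set [::]] t).
  apply: foldl_invariant => [|H U Hf _]; first exact: finite_set1.
  by rewrite finite_setU; split=> //; exact: finite_image.
exists sigma => [s U /legal_rcons[ls oU]|U oU].
  by rewrite /sigma machine_rcons; have [] := Hresp (_, U) (Hfin _ ls) oU.
pose H n := foldl step [set [::]] (mkseq U n).
pose W n := resp (H n, U n).
have -> : (fun n => sigma (mkseq U n.+1)) = W.
  by apply/funext => n; rewrite /sigma mkseqS machine_rcons.
have WP n : respP (H n) (U n) (W n).
  exact: (Hresp (H n, U n) (Hfin _ (legal_mkseq oU)) (oU n)).
have Wopen n : open (W n).
  by have [[Uo _] _] := oU n; apply: Uo; have [] := WP n.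
have HS n : H n.+1 = step (H n) (U n) by exact: foldl_mkseqS.
(* If [x] is missed infinitely often, the choices missing it form a run against [p], which must
   cover [x]. *)
have Wev x : exists m, forall n, (m <= n)%N -> W n x.
  apply: contrapT => /forallNP nx.
  have [m|u [_ [uS nW]]] :=
      @infinitely_often_subsequence unit (fun n _ => ~ W n x).
    have /existsNP[n /not_implyP[mn nWx]] := nx m.
    by exists n; split=> //; exists tt.
  have Hu : forall j, H (u j) (mkseq (W \o u) j).
    apply: subsequence_history => // [n|i h Hh]; rewrite HS.
      by split=> // h Hh; left.
    by right; exists h.
  have [|_ cov] := pW (W \o u).
    move=> n; split; first exact: Wopen.
    by move=> _ ->; have [_] := WP (u n); apply; exact: Hu.
  have : [set: X] x by [].
  by rewrite -cov => -[_ [n _ <-]] /nW.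
have Wevs (s : seq X) : exists m, forall n, (m <= n)%N -> [set` s] `<=` W n.
  elim: s => [|x s [m Hm]]; first by exists 0 => n _ y.
  have [k Hk] := Wev x; exists (maxn m k) => n; rewrite geq_max => /andP[mn kn] y.
  by rewrite /= inE => /predU1P[->|ys]; [exact: Hk|exact: Hm].
split; first split=> [_ [n _ <-]//|].
  apply/seteqP; split=> // x _; have [m /(_ m (leqnn m)) Wx] := Wev x.
  by exists (W m) => //; exists m.
move=> F /finite_seqP[s ->]; have [m /(_ m (leqnn m)) Ws] := Wevs s.
by exists (W m) => //; exists m.
Qed.

(* P2 treats the finite set played by the dual strategy point by point: the
   state records the open sets completed so far, the part of the current one
   already chosen, and the points still to be covered. *)
Lemma omega_Rothberger_plain : [set: X] !=set0 ->
  strategically_omega_Rothberger X -> strategically_Rothberger X.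
Proof.
(* Demanded finite sets are coded by a head and a tail: they are nonempty, so treating one of them
   takes at least one round. *)
move=> [x0 _] /(@P1_dual_strategy _ (X * seq X)%type (x0, [::])
  (fun i => [set` i.1 :: i.2])) [V oV|p pW].
  have FV F : finite_set F -> exists2 W, range V W & F `<=` W.
    move=> /finite_seqP[s ->]; exists (V (x0, s)); first by exists (x0, s).
    move=> y ys; have [_ ] := oV (x0, s); apply.
    by rewrite /= inE; apply/orP; right.
  split=> //; split=> [_ [i _ <-]|]; first by have [] := oV i.
  apply/seteqP; split=> // x _.
  by have [W VW xW] := FV _ (finite_set1 x); exists W => //; exact: xW.
pose pts vs := (p vs).1 :: (p vs).2.
have /choice[pick Hpick] (z : X * set (set X)) : exists W,
    open_cover z.2 -> z.2 W /\ W z.1.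
  case: z => x U /=.
  have [oU|nU] := pselect (open_cover U); last by exists set0.
  have : [set: X] x by [].
  by rewrite -oU.2 => -[W UW Wx]; exists W.
pose state := (seq (set X) * set X * seq X)%type.
pose resp (z : state) U := pick (head x0 z.2, U).
pose step (z : state) U : state :=
  let: (vs, acc, xs) := z in let acc' := acc `|` resp z U in
  (* [xs] still includes the point covered in this round. If it is the last one, [acc'] contains the
     whole demanded set and becomes the next open set played against [p]. *)
  if (1 < size xs)%N then (vs, acc', behead xs)
  else (rcons vs acc', set0, pts (rcons vs acc')).
pose start : state := ([::], set0, pts [::]).
exists (machine step resp start) => [s U /legal_rcons[_ oU]|U oU].
  rewrite machine_rcons.
  by have [] := Hpick (head x0 (foldl step start s).2, U) oU.
pose st n := foldl step start (mkseq U n).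
pose W n := resp (st n) (U n).
have -> : (fun n => machine step resp start (mkseq U n.+1)) = W.
  by apply/funext => n; rewrite mkseqS machine_rcons.
have WP n : U n (W n) /\ W n (head x0 (st n).2).
  exact: (Hpick (head x0 (st n).2, U n) (oU n)).
have Wopen n : open (W n) by have [Uo _] := oU n; apply: Uo; have [] := WP n.
have stS n : st n.+1 = step (st n) (U n) by exact: foldl_mkseqS.
(* Induction on the points left: in round [nV.1] the open set [nV.2] is complete. Its upper bound
   later traces a point of a completed set back to a single choice. *)
have block x xs m vs acc : open acc -> st m = (vs, acc, x :: xs) ->
    exists nV : nat * set X, [/\ open nV.2, acc `|` [set` x :: xs] `<=` nV.2,
      nV.2 `<=` acc `|` \bigcup_n W n &
      st nV.1 = (rcons vs nV.2, set0, pts (rcons vs nV.2))].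
  elim: xs x m acc => [|y xs IH] x m acc oacc stm.
    exists (m.+1, acc `|` W m); split=> /=.
    - exact: openU.
    - move=> z [|]; first by left.
      rewrite /= inE => /eqP->; right.
      by have [_] := WP m; rewrite stm.
    - by move=> z [|Wz]; [left|right; exists m].
    - by rewrite stS stm /step -stm.
  have [||[n V] /= [oV accV Vacc stn]] := IH y m.+1 (acc `|` W m).
  - exact: openU.
  - by rewrite stS stm /step -stm.
  exists (n, V); split=> //= z.
    case=> [accz|]; first by apply: accV; left; left.
    rewrite /= inE => /predU1P[->|zs]; last by apply: accV; right.
    by apply: accV; left; right; have [_] := WP m; rewrite stm.
  by move=> /Vacc[[|Wz]|]; [left|right; exists m|right].
have next (mvs : nat * seq (set X)) : exists nV : nat * set X,
    st mvs.1 = (mvs.2, set0, pts mvs.2) ->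
    [/\ open nV.2, [set` pts mvs.2] `<=` nV.2, nV.2 `<=` \bigcup_n W n &
      st nV.1 = (rcons mvs.2 nV.2, set0, pts (rcons mvs.2 nV.2))].
  case: mvs => m vs /=; have [stm|nst] := pselect (st m = (vs, set0, pts vs)).
    have [nV] := block _ _ _ _ _ (open0) stm.
    by rewrite !set0U => nVP; exists nV.
  by exists (0, set0) => /nst.
have [f fP] := choice next.
pose r := fix r j := if j is k.+1 then ((f (r k)).1, rcons (r k).2 (f (r k)).2)
  else (0, [::]).
pose V j := (f (r j)).2.
have rP j : st (r j).1 = ((r j).2, set0, pts (r j).2).
  by elim: j => // j IH; have [] := fP (r j) IH.
have rV j : (r j).2 = mkseq V j by elim: j => // j IH; rewrite mkseqS -IH.
have [|[_ cov] _] := pW V.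
  by move=> j; rewrite -rV; have [oV pV _ _] := fP (r j) (rP j).
split=> [_ [n _ <-]//|]; apply/seteqP; split=> // x _.
have : [set: X] x by [].
rewrite -cov => -[_ [j _ <-] Vx].
have [_ _ /(_ x Vx)[n _ Wx] _] := fP (r j) (rP j).
by exists (W n) => //; exists n.
Qed.

End Rothberger.

(** * The Menger games *)

Section Menger.
Variable X : topologicalType.

(** The strategy [tau k] joins in round [k] and sees only the covers from there on; in each round
    only finitely many strategies have joined, so the selection stays finite. *)
Definition staggered (Y : Type) (tau : nat -> seq (set Y) -> set Y)
    (s : seq (set Y)) : set Y :=
  \bigcup_(k in `I_(size s)) tau k (drop k s).

Lemma staggered_strategy (A : set (set (set X))) tau :
  (forall k, Gfin_strategy A (tau k)) -> Gfin_strategy A (staggered tau).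
Proof.
move=> tauS s U lsU.
have drops k : `I_(size (rcons s U)) k ->
    finite_set (tau k (drop k (rcons s U))) /\
    tau k (drop k (rcons s U)) `<=` U.
  rewrite /= size_rcons ltnS => ks; rewrite drop_rcons //; apply: tauS => V.
  by rewrite -drop_rcons // => /mem_drop/lsU.
split; first by apply: bigcup_finite => [|k /drops[]//]; exact: finite_II.
by move=> W [k /drops[_ sub]] /sub.
Qed.

Lemma staggered_tail (Y : Type) (tau : nat -> seq (set Y) -> set Y)
    (U : nat -> set Y) k n :
  tau k (mkseq (fun i => U (k + i)) n.+1) `<=` staggered tau (mkseq U (k + n).+1).
Proof.
have kn : (k < size (mkseq U (k + n).+1))%N.
  by rewrite size_mkseq ltnS leq_addr.
move=> W tauW; exists k => //.
rewrite /mkseq -map_drop drop_iota add0n -addnS addKn.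
by rewrite -[k in iota k]addn0 iotaDl -map_comp.
Qed.

(** A fresh copy of the same winning strategy starts in every round; the copy started in round [m]
    covers [x] in some round from [m] on. *)
Lemma Menger_infinitely_often : strategically_Menger X ->
  exists2 sigma, Gfin_strategy (@open_cover X) sigma &
    forall U, (forall n, open_cover (U n)) -> forall x m, exists n,
      (m <= n)%N /\ exists2 V, sigma (mkseq U n.+1) V & V x.
Proof.
move=> [sigma sigmaS sigmaW]; exists (staggered (fun=> sigma)).
  exact: staggered_strategy.
move=> U oU x m; have [_ cov] := sigmaW _ (fun n => oU (m + n)).
have : [set: X] x by [].
rewrite -cov => -[V [n _ sV] Vx]; exists (m + n); split; first exact: leq_addr.
by exists V => //; apply: staggered_tail sV.
Qed.

(** The statement proved by induction on the number of points: a single strategy serves all sets of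
    [D]. *)
Definition P2_catches (D : set (set X)) : Prop :=
  exists2 tau, Gfin_strategy (@omega_cover X) tau &
    forall U, (forall n, omega_cover (U n)) -> forall F, D F ->
      exists n, exists2 W, tau (mkseq U n.+1) W & F `<=` W.

Lemma P2_catches_set0 : P2_catches [set set0].
Proof.
have /choice[pick Hpick] U : exists W, @omega_cover X U -> U W.
  have [[_ oU]|nU] := pselect (omega_cover U).
    by have [W UW _] := oU _ (finite_set0 X); exists W.
  by exists set0.
exists (fun s => [set pick (last set0 s)]) => [s U /legal_rcons[_ oU]|U oU _ ->].
  rewrite last_rcons; split; first exact: finite_set1.
  by move=> _ ->; exact: Hpick.
by exists 0, (pick (U 0)).
Qed.

(** A finite set can be enlarged by [x] before a member containing it is sought. *)
Lemma omega_cover_through (U : set (set X)) x :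
  omega_cover U -> omega_cover (U `&` [set W | W x]).
Proof.
move=> [[Uo Uc] UF].
have FU F : finite_set F -> exists2 W, (U `&` [set W | W x]) W & F `<=` W.
  move=> Ff; have [|W UW FxW] := UF (F `|` [set x]).
    by rewrite finite_setU; split=> //; exact: finite_set1.
  by exists W => [|y Fy]; [split=> //|]; apply: FxW; [right|left].
split=> //; split=> [W [/Uo]//|]; apply/seteqP; split=> // y _.
by have [W UW yW] := FU _ (finite_set1 y); exists W => //; exact: yW.
Qed.

(* For each [x], the histories of P2's given strategy on the sets [F], applied
   to the members of the current cover through [x], yield finitely many
   members, whose intersection is a neighbourhood of [x]; the Menger strategy
   then picks finitely many of these neighbourhoods. A point [a] is picked
   infinitely often, and along the rounds where it is picked, the given
   strategy produces a member containing [F], which also contains [a]. *)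
Lemma P2_catches_setU1 (D : set (set X)) : strategically_Menger X ->
  P2_catches D -> P2_catches [set F `|` [set a] | F in D & a in [set: X]].
Proof.
move=> /Menger_infinitely_often[sigma sigmaS sigmaW] [tau tauS tauW].
(* A state holds the open covers fed to [sigma] so far and the finite set of histories kept for
   [tau]. *)
pose state := (seq (set (set X)) * set (seq (set (set X))))%type.
pose thru (U : set (set X)) x := U `&` [set W | W x].
pose reply (H : set (seq (set (set X)))) U x :=
  \bigcup_(h in H) tau (rcons h (thru U x)).
pose nb H U x := \bigcap_(W in reply H U x) W.
pose I (z : state) := [/\ legal (@open_cover X) z.1, finite_set z.2 &
  forall h, z.2 h -> legal (@omega_cover X) h].
pose cover (z : state) U := range (nb z.2 U).
have replyP z U x : I z -> omega_cover U ->
    finite_set (reply z.2 U x) /\ reply z.2 U x `<=` thru U x.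
  move=> [_ Hf Hl] oU.
  have tauP h : z.2 h -> finite_set (tau (rcons h (thru U x))) /\
      tau (rcons h (thru U x)) `<=` thru U x.
    move=> /Hl lh; apply: tauS; apply/legal_rcons; split=> //.
    exact: omega_cover_through.
  split; first by apply: bigcup_finite => // h /tauP[].
  by move=> W [h /tauP[_ sub]] /sub.
have coverP z U : I z -> omega_cover U -> open_cover (cover z U).
  move=> Iz oU; split=> [_ [x _ <-]|].
    have [rf rU] := replyP z U x Iz oU.
    apply: open_finite_bigcap => // W /rU[UW _].
    by case: oU => -[Uo _] _; exact: Uo.
  apply/seteqP; split=> // x _; exists (nb z.2 U x); first by exists x.
  by move=> W; have [_ rU] := replyP z U x Iz oU => /rU[].
(* The finitely many neighbourhoods picked by [sigma] are traced back to finitely many points, which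
   index the new histories. *)
have /choice[pts Hpts] (zU : state * set (set X)) : exists A, I zU.1 ->
    omega_cover zU.2 -> finite_set A /\
    sigma (rcons zU.1.1 (cover zU.1 zU.2)) = nb zU.1.2 zU.2 @` A.
  case: zU => z U /=.
  have [[Iz oU]|nI] := pselect (I z /\ omega_cover U); last first.
    by exists set0 => Iz oU; case: nI.
  have [|sf ssub] := sigmaS z.1 (cover z U).
    by apply/legal_rcons; split; [have [] := Iz|exact: coverP].
  by have [A Af sA] := finite_subset_range sf ssub; exists A.
pose resp z U := \bigcup_(x in pts (z, U)) reply z.2 U x.
pose step (z : state) U : state := (rcons z.1 (cover z U),
  z.2 `|` [set rcons h (thru U x) | h in z.2 & x in pts (z, U)]).
pose start : state := ([::], [set [::]]).
have IS t : legal (@omega_cover X) t -> I (foldl step start t).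
  apply: foldl_invariant => [|z U Iz oU].
    by split=> //= _ ->.
  have [lz Hf Hl] := Iz; have [pf _] := Hpts (z, U) Iz oU; split=> /=.
  - by apply/legal_rcons; split=> //; exact: coverP.
  - by rewrite finite_setU; split=> //; exact: finite_image2.
  - move=> h [/Hl//|[h' Hh' [x _ <-]]]; apply/legal_rcons; split.
      exact: Hl.
    exact: omega_cover_through.
exists (machine step resp start) => [s U /legal_rcons[ls oU]|U oU].
  rewrite machine_rcons; set z := foldl _ _ _; have Iz : I z := IS _ ls.
  split; last by move=> W [x _]; have [_ sub] := replyP z U x Iz oU => /sub[].
  by apply: bigcup_finite => [|x _]; [have [] := Hpts (z, U) Iz oU|
    have [] := replyP z U x Iz oU].
pose st n := foldl step start (mkseq U n).
have Ist n : I (st n) by apply: IS; exact: legal_mkseq.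
have stS n : st n.+1 = step (st n) (U n) by exact: foldl_mkseqS.
pose O n := cover (st n) (U n).
have oO n : open_cover (O n) by exact: coverP.
have stO n : (st n).1 = mkseq O n by elim: n => // n IH; rewrite mkseqS stS -IH.
move=> _ [F DF [a _ <-]].
have [m|u [x [uS xP]]] := @infinitely_often_subsequence X
    (fun n x => pts (st n, U n) x /\ nb (st n).2 (U n) x a).
  have [n [mn [V sV Va]]] := sigmaW O oO a m; exists n; split=> //.
  have [_ sE] := Hpts (st n, U n) (Ist n) (oU n).
  move: sV; rewrite mkseqS -stO sE => -[x px xV].
  by exists x; split=> //; rewrite xV.
pose c i := thru (U (u i)) (x i).
have Hu : forall j, (st (u j)).2 (mkseq c j).
  apply: (subsequence_history (H := fun n => (st n).2)) => // [n|i h Hh].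
    by split=> // h Hh; rewrite stS; left.
  by rewrite stS; right; exists h => //; exists (x i); have [] := xP i.
have oc i : omega_cover (c i) by exact: omega_cover_through.
(* The covers [c] form a run of [tau] whose initial segments are all kept as histories, so [W] is
   among the replies intersected in the neighbourhood of [x j], which contains [a]. *)
have [j [W tW FW]] := tauW c oc F DF.
have rW : reply (st (u j)).2 (U (u j)) (x j) W.
  by exists (mkseq c j) => //; rewrite -mkseqS.
have [px xa] := xP j.
exists (u j), W; last by move=> y [/FW//|->]; exact: xa.
by rewrite mkseqS machine_rcons; exists (x j).
Qed.

Lemma Menger_omega :
  strategically_Menger X -> strategically_omega_Menger X.
Proof.
move=> XM.
(* Lists of length [k], with repetitions allowed, replace sets of [k] points. *)
have catch k : P2_catches [set [set` s] | s in [set s : seq X | size s = k]].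
  elim: k => [|k /(P2_catches_setU1 XM)[tau tauS tauW]].
    have [tau tauS tauW] := P2_catches_set0.
    exists tau => // U oU _ [s /size0nil-> <-].
    by apply: tauW => //; exact: set_nil.
  exists tau => // U oU _ [[//|a s] [sk] <-]; apply: tauW => //.
  exists [set` s]; first by exists s.
  exists a => //; apply/seteqP; split=> y /=; rewrite inE.
    by move=> [->|->]; rewrite ?eqxx ?orbT.
  by move=> /predU1P[->|]; [right|left].
have /choice[tau tauP] k : exists tau, Gfin_strategy (@omega_cover X) tau /\
    forall U, (forall n, omega_cover (U n)) -> forall s, size s = k ->
      exists n, exists2 W, tau (mkseq U n.+1) W & [set` s] `<=` W.
  have [tau tauS tauW] := catch k; exists tau; split=> //.
  by move=> U oU s sk; apply: tauW => //; exists s.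
have mS : Gfin_strategy (@omega_cover X) (staggered tau).
  by apply: staggered_strategy => k; have [] := tauP k.
exists (staggered tau) => // U oU.
have FW F : finite_set F ->
    exists2 W, (\bigcup_n staggered tau (mkseq U n.+1)) W & F `<=` W.
  move=> /finite_seqP[s ->].
  (* The strategy for lists of length [size s] starts in round [size s], hence the shifted run. *)
  have [_ /(_ _ (fun n => oU (size s + n)) s erefl)[n [W tW sW]]] :=
    tauP (size s).
  by exists W => //; exists (size s + n) => //; apply: staggered_tail tW.
split=> //; split=> [W [n _]|].
  rewrite mkseqS => mW; have [|_ /(_ _ mW) UW] := mS (mkseq U n) (U n).
    by rewrite -mkseqS; exact: legal_mkseq.
  by have [[Uo _] _] := oU n; exact: Uo.
apply/seteqP; split=> // x _.
by have [W mW xW] := FW _ (finite_set1 x); exists W => //; exact: xW.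
Qed.

Lemma omega_cover_finite_unions (U : set (set X)) : open_cover U ->
  omega_cover [set \bigcup_(V in G) V | G in [set G | finite_set G /\ G `<=` U]].
Proof.
move=> [Uo Uc].
have FW F : finite_set F -> exists2 W,
    [set \bigcup_(V in G) V | G in [set G | finite_set G /\ G `<=` U]] W &
    F `<=` W.
  move=> Ff.
  have /choice[g gP] x : exists V, U V /\ V x.
    have : [set: X] x by [].
    by rewrite -Uc => -[V UV Vx]; exists V.
  exists (\bigcup_(V in g @` F) V).
    exists (g @` F) => //; split; first exact: finite_image.
    by move=> _ [x _ <-]; have [] := gP x.
  by move=> x Fx; exists (g x); [exists x|have [] := gP x].
split=> //; split=> [_ [G [_ GU] <-]|].
  by apply: bigcup_open => V /GU/Uo.
apply/seteqP; split=> // x _.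
by have [W mW xW] := FW _ (finite_set1 x); exists W => //; exact: xW.
Qed.

(** The given strategy is run on the covers by finite unions, and each union it selects is replaced
    by finitely many members composing it. *)
Lemma omega_Menger_plain :
  strategically_omega_Menger X -> strategically_Menger X.
Proof.
move=> [sigma sigmaS sigmaW].
pose fu (U : set (set X)) :=
  [set \bigcup_(V in G) V | G in [set G | finite_set G /\ G `<=` U]].
(* The decomposition depends on the cover too, since its pieces must be members of the current
   one. *)
have /choice[dec decP] (z : set (set X) * set X) : exists G, fu z.1 z.2 ->
    [/\ finite_set G, G `<=` z.1 & \bigcup_(V in G) V = z.2].
  case: z => U W /=.
  have [[G [Gf GU] GW]|nW] := pselect (fu U W); first by exists G.
  by exists set0 => /nW.
pose tau s := \bigcup_(W in sigma (map fu s)) dec (last set0 s, W).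
have sigmaP s U : legal (@open_cover X) (rcons s U) ->
    finite_set (sigma (map fu (rcons s U))) /\
    sigma (map fu (rcons s U)) `<=` fu U.
  move=> lsU; rewrite map_rcons; apply: sigmaS => V; rewrite -map_rcons.
  by move=> /mapP[V' /lsU oV' ->]; exact: omega_cover_finite_unions.
exists tau => [s U lsU|U oU].
  have [sf ssub] := sigmaP s U lsU; rewrite /tau last_rcons; split.
    by apply: bigcup_finite => // W /ssub fW; have [] := decP (U, W) fW.
  by move=> V [W /ssub fW]; have [_ sub _] := decP (U, W) fW => /sub.
have fuP n W : sigma (map fu (mkseq U n.+1)) W -> fu (U n) W.
  rewrite mkseqS; have [|_ sub /sub//] := sigmaP (mkseq U n) (U n).
  by rewrite -mkseqS; exact: legal_mkseq.
split=> [V [n _ [W /fuP fW]]|].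
  rewrite mkseqS last_rcons => dV; have [_ sub _] := decP (U n, W) fW.
  by have [Uo _] := oU n; exact/Uo/sub.
have [[_ cov] _] := sigmaW _ (fun n => omega_cover_finite_unions (oU n)).
apply/seteqP; split=> // x _; have : [set: X] x by [].
rewrite -cov => -[W [n _ sW] Wx].
have sW' : sigma (map fu (mkseq U n.+1)) W by rewrite -map_comp.
have [_ _ dW] := decP (U n, W) (fuP _ _ sW').
move: Wx; rewrite -[W]/((U n, W).2) -dW => -[V dV Vx]; exists V => //.
by exists n => //; exists W => //; rewrite mkseqS last_rcons.
Qed.

End Menger.

(** Nonemptiness matters for the Rothberger part: the only omega-cover of the empty space is the
    singleton of [set0], so P2 wins the omega-game there, but has no reply to the empty open
    cover. *)
Theorem theorem4p5 (X : topologicalType) :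
  (strategically_omega_Menger X <-> strategically_Menger X) /\
  ([set: X] !=set0 ->
   (strategically_omega_Rothberger X <-> strategically_Rothberger X)).
Proof.
split=> [|X0]; split.
- exact: omega_Menger_plain.
- exact: Menger_omega.
- exact: omega_Rothberger_plain.
- exact: Rothberger_omega.
Qed.
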